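(* Let $X$ and $Y$ be real locally convex topological vector spaces and let $F\colon X\rightrightarrows Y$ be a set-valued mapping whose graph is convex. If both $\operatorname{gph}(F)$ and $\operatorname{dom}(F)$ are quasi-regular, then $$\operatorname{qri}\big(\operatorname{gph}(F)\big)=\big\{(x,y)\in X\times Y\;\big|\;x\in\operatorname{qri}\big(\operatorname{dom}(F)\big),\;y\in\operatorname{qri}\big(F(x)\big)\big\}.$$
   Context: For a nonempty subset $A$ of a real locally convex topological vector space $Z$, $\operatorname{cone}(A):=\{ta\mid t\ge 0,\ a\in A\}$ and $\overline{\operatorname{cone}}(A)$ is its closure. For a nonempty convex set $\Omega\subset Z$, the intrinsic relative interior is $\operatorname{iri}(\Omega):=\{x\in\Omega\mid \operatorname{cone}(\Omega-x)\text{ is a linear subspace of }Z\}$ and the quasi-relative interior is $\operatorname{qri}(\Omega):=\{x\in\Omega\mid \overline{\operatorname{cone}}(\Omega-x)\text{ is a linear subspace of }Z\}$; by convention $\operatorname{iri}(\emptyset)=\operatorname{qri}(\emptyset)=\emptyset$. A convex set $\Omega$ is called quasi-regular if $\operatorname{qri}(\Omega)=\operatorname{iri}(\Omega)$. For a set-valued mapping $F\colon X\rightrightarrows Y$ (assigning to each $x\in X$ a possibly empty subset $F(x)\subset Y$), $\operatorname{gph}(F):=\{(x,y)\in X\times Y\mid y\in F(x)\}$ and $\operatorname{dom}(F):=\{x\in X\mid F(x)\ne\emptyset\}$. *)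

(* Defs.v *)
From mathcomp Require Import all_boot all_order all_algebra.
From mathcomp Require Import all_classical all_reals all_analysis.

Set Implicit Arguments.
Unset Strict Implicit.
Unset Printing Implicit Defensive.

Import Order.TTheory GRing.Theory Num.Theory.
Import numFieldNormedType.Exports.

Local Open Scope classical_set_scope.
Local Open Scope ring_scope.

(* No Hausdorff axiom is assumed: [tvsType R] is a topological vector space
   over [R] whose topology has a basis of convex open sets. *)

Definition linear_subspace (R : realType) (Z : lmodType R) (A : set Z) : Prop :=
  submod_closed (mem A).

Definition cone (R : realType) (Z : lmodType R) (A : set Z) : set Z :=
  [set t *: a | t in [set t : R | 0 <= t] & a in A].

Definition translate_sub (R : realType) (Z : lmodType R) (A : set Z) (x : Z) :
  set Z := [set a - x | a in A].

Definition iri (R : realType) (Z : lmodType R) (Omega : set Z) : set Z :=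
  [set x | Omega x /\ linear_subspace (cone (translate_sub Omega x))].

Definition qri (R : realType) (Z : tvsType R) (Omega : set Z) : set Z :=
  [set x | Omega x /\ linear_subspace (closure (cone (translate_sub Omega x)))].

(* Convexity of [Omega] is left to separate hypotheses; for a convex graph,
   the domain and the values [F x] are automatically convex. *)
Definition quasi_regular (R : realType) (Z : tvsType R) (Omega : set Z) : Prop :=
  qri Omega = iri Omega.

(* A set-valued mapping from X to Y is a function [F : X -> set Y]. *)
Definition gph (X Y : Type) (F : X -> set Y) : set (X * Y) :=
  [set xy | F xy.1 xy.2].

Definition dom (X Y : Type) (F : X -> set Y) : set X :=
  [set x | F x !=set0].

(* Main.v *)
Require Import Defs.
From mathcomp Require Import all_boot all_order all_algebra.
From mathcomp Require Import all_classical all_reals all_analysis.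

Set Implicit Arguments.
Unset Strict Implicit.
Unset Printing Implicit Defensive.

Import Order.TTheory GRing.Theory Num.Theory.
Import numFieldNormedType.Exports.

Local Open Scope classical_set_scope.
Local Open Scope ring_scope.

(* Write K for the cone of gph F - (x, y).  The cone of dom F - x is the first
   projection of K, and the cone of F x - y is the fibre of K over 0, so both
   are subspaces when K is.
   Conversely, let cone (dom F - x) and the closure of cone (F x - y) be
   subspaces, and let (u, v) be in K.  Then K contains some (- u, v'), hence
   also (0, v + v'); so (0, - (v + v')) is in the closure of K, and adding
   (- u, v') puts - (u, v) there.  The closure of K is thus a subspace. *)

Lemma linear_subspaceP (R : realType) (Z : lmodType R) (A : set Z) :
  linear_subspace A <->
  A 0 /\ forall (a : R) u v, A u -> A v -> A (a *: u + v).
Proof.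
split=> [[/set_mem A0 lA]|[A0 lA]]; split; rewrite ?inE//.
- by move=> a u v Au Av; apply/set_mem/lA; rewrite inE.
- by move=> a u v; rewrite !inE => Au Av; exact: lA.
Qed.

Lemma linear_subspaceN (R : realType) (Z : lmodType R) (A : set Z) u :
  linear_subspace A -> A u -> A (- u).
Proof.
move=> /linear_subspaceP[A0 lA] Au.
by rewrite -scaleN1r -[_ *: _]addr0; exact: lA.
Qed.

Lemma cone_translateP (R : realType) (Z : lmodType R) (A : set Z) (x v : Z) :
  cone (translate_sub A x) v <->
  exists t a, [/\ 0 <= t, A a & v = t *: (a - x)].
Proof.
split=> [[t /= t0 [_ [a Aa <-] <-]]|[t [a [t0 Aa ->]]]]; first by exists t, a.
by exists t => //; exists (a - x) => //; exists a.
Qed.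

Section convex_cone.
Variables (R : realType) (Z : lmodType R) (A : set Z) (x : Z).
Let K := cone (translate_sub A x).

Lemma cone_translate0 : A x -> K 0.
Proof.
by move=> Ax; apply/cone_translateP; exists 0, x; split; rewrite // scale0r.
Qed.

Lemma cone_translate_sub (a : Z) : A a -> K (a - x).
Proof. by move=> Aa; apply/cone_translateP; exists 1, a; rewrite scale1r. Qed.

Lemma cone_translateZ (t : R) v : 0 <= t -> K v -> K (t *: v).
Proof.
move=> t0 /cone_translateP[s [a [s0 Aa ->]]]; apply/cone_translateP.
by exists (t * s), a; rewrite mulr_ge0// scalerA.
Qed.

(** The weights in [convex_set] are bundled elements of the unit interval; this form takes a bare
    scalar with its two bounds. *)
Lemma convex_set_combination : convex_set A -> forall (t : R) a b,
  0 <= t -> t <= 1 -> A a -> A b -> A (t *: a + (1 - t) *: b).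
Proof.
move=> cA t a b t0 t1 Aa Ab.
have t01 : Itv.spec (Itv.num_sem (R:=R)) (Itv.Real `[0%Z, 1%Z]) t.
  by rewrite /= /Itv.num_sem/= in_itv/= t0 t1 ger0_real.
have := cA a b (Itv.mk t01); rewrite !inE; exact.
Qed.

(** For s + t > 0, s(a - x) + t(b - x) = (s + t)(c - x), where c is the convex combination of a and
    b with weights s/(s + t) and t/(s + t). *)
Lemma cone_translateD (cA : convex_set A) v w : K v -> K w -> K (v + w).
Proof.
move=> /cone_translateP[s [a [s0 Aa ->]]] /cone_translateP[t [b [t0 Ab ->]]].
have [st0|st0] := eqVneq (s + t) 0.
  have [-> ->] : s = 0 /\ t = 0.
    by move/eqP: st0; rewrite paddr_eq0// => /andP[/eqP-> /eqP->].
  (* Here [A x] is not at hand, so 0 is reached as the multiple 0 of a - x. *)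
  by rewrite !scale0r addr0 -[0](scale0r (a - x)); apply: cone_translateZ => //;
    exact: cone_translate_sub.
apply/cone_translateP.
exists (s + t), (s / (s + t) *: a + (1 - s / (s + t)) *: b); split.
- exact: addr_ge0.
- apply: convex_set_combination => //; first by rewrite divr_ge0// addr_ge0.
  by rewrite ler_pdivrMr ?mul1r ?lerDl// lt_neqAle eq_sym st0 addr_ge0.
- set r := s / (s + t).
  have sE : s = (s + t) * r by rewrite /r mulrCA divff ?mulr1.
  have tE : t = (s + t) * (1 - r) by rewrite mulrBr -sE mulr1 addrC addKr.
  clearbody r; rewrite [in LHS]sE [X in _ + X *: _]tE -!scalerA -scalerDr.
  by congr (_ *: _); rewrite !scalerBr addrACA -opprD -scalerDl subrKC scale1r.
Qed.

End convex_cone.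

Section closure_cone.
Variables (R : realType) (Z : tvsType R).

(** The preimage of [closure B] under [f] is closed and contains [A], hence contains [closure A]. *)
Lemma closure_map (A B : set Z) (f : Z -> Z) : continuous f ->
  (forall a, A a -> closure B (f a)) ->
  forall a, closure A a -> closure B (f a).
Proof.
move=> cf AB; rewrite [closure A]closureE => a /(_ (f @^-1` closure B)); apply.
split; last exact: AB.
by apply: preimage_closed => [b _|]; [exact: cf|exact: closed_closure].
Qed.

Lemma continuous_addl (u : Z) : continuous (+%R u).
Proof.
move=> v; apply: (@continuous_comp Z (Z * Z)%type Z (fun y => (u, y))
  (fun y => y.1 + y.2)); last exact: add_continuous.
by apply: cvg_pair; [exact: cvg_cst|exact: cvg_id].
Qed.

Lemma continuous_scalel (t : R) : continuous (fun v : Z => t *: v).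
Proof.
move=> v; apply: (@continuous_comp Z (R^o * Z)%type Z (fun y => (t : R^o, y))
  (fun y => y.1 *: y.2)); last exact: scale_continuous.
by apply: (@cvg_pair _ _ _ _ (nbhs (t : R^o))); [exact: cvg_cst|exact: cvg_id].
Qed.

(** Translations are continuous, so the two summands pass to the closure one after the other. *)
Lemma closureD (A : set Z) : (forall u v, A u -> A v -> A (u + v)) ->
  forall u v, closure A u -> closure A v -> closure A (u + v).
Proof.
move=> AD u v + cv; rewrite addrC; apply: closure_map.
  exact: continuous_addl.
move=> w Aw; rewrite addrC; apply: (closure_map _ _ cv).
  exact: continuous_addl.
by move=> z Az; apply: subset_closure; exact: AD.
Qed.

(** Negation is continuous, so once it maps [A] into [closure A] it maps [closure A] into itself.
    This weak form of symmetry is what can be checked for the cone of the graph. *)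
Lemma closure_linear_subspace (A : set Z) :
  A 0 -> (forall u v, A u -> A v -> A (u + v)) ->
  (forall t u, 0 <= t -> A u -> A (t *: u)) ->
  (forall u, A u -> closure A (- u)) ->
  linear_subspace (closure A).
Proof.
move=> A0 AD AZ AN; apply/linear_subspaceP; split; first exact: subset_closure.
have cZ t u : 0 <= t -> closure A u -> closure A (t *: u).
  move=> t0; apply: closure_map; first exact: continuous_scalel.
  by move=> w Aw; apply: subset_closure; exact: AZ.
move=> t u v cu; apply: closureD => //.
have [t0|t0] := leP 0 t; first exact: cZ.
(* A negative t acts as the nonnegative scalar -t followed by negation. *)
rewrite -[t]opprK scaleNr -scaleN1r.
apply: (closure_map (continuous_scalel (t := _))) (cZ _ _ _ cu).
  by move=> w Aw; rewrite scaleN1r; exact: AN.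
by rewrite oppr_ge0 ltW.
Qed.

Lemma iri_sub_qri (A : set Z) : iri A `<=` qri A.
Proof.
move=> x [Ax /linear_subspaceP[K0 lK]]; split => //.
apply: closure_linear_subspace => //.
- by move=> u v Ku Kv; rewrite -[u]scale1r; exact: lK.
- by move=> t u _ Ku; rewrite -[_ *: _]addr0; exact: lK.
- move=> u Ku; apply: subset_closure.
  by apply: linear_subspaceN => //; exact/linear_subspaceP.
Qed.

End closure_cone.

Section graph.
Variables (R : realType) (X Y : tvsType R) (F : X -> set Y).
Variables (x : X) (y : Y).

Lemma cone_dom (u : X) : cone (translate_sub (dom F) x) u <->
  exists v : Y, cone (translate_sub (gph F) (x, y)) (u, v).
Proof.
split=> [/cone_translateP[t [a [t0 [b Fab] ->]]]|[v]].
  exists (t *: (b - y)); apply/cone_translateP.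
  by exists t, (a, b).
move=> /cone_translateP[t [[a b] [t0 Fab [-> _]]]].
by apply/cone_translateP; exists t, a; split => //; exists b.
Qed.

Lemma cone_value (Fxy : F x y) (v : Y) : cone (translate_sub (F x) y) v <->
  cone (translate_sub (gph F) (x, y)) (0, v).
Proof.
split=> [/cone_translateP[t [b [t0 Fb ->]]]|].
  apply/cone_translateP; exists t, (x, b); split => //.
  by congr pair; rewrite /= subrr scaler0.
move=> /cone_translateP[t [[a b] [t0 Fab [/esym/eqP + ->]]]].
(* From t(a - x) = 0, either t = 0 and the vector is 0, or a = x and b lies in [F x]. *)
rewrite scaler_eq0 subr_eq0 => /orP[/eqP->|/eqP ax].
  by rewrite scale0r; exact: cone_translate0.
by apply/cone_translateP; exists t, b; rewrite -ax.
Qed.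

Lemma iri_gph_dom : iri (gph F) (x, y) -> iri (dom F) x.
Proof.
move=> [Fxy /linear_subspaceP[K0 lK]]; split; first by exists y.
apply/linear_subspaceP; split; first by apply/cone_dom; exists 0.
move=> a u v /cone_dom[u' Ku] /cone_dom[v' Kv]; apply/cone_dom.
by exists (a *: u' + v'); exact: (lK a _ _ Ku Kv).
Qed.

Lemma iri_gph_value : iri (gph F) (x, y) -> iri (F x) y.
Proof.
move=> [Fxy /linear_subspaceP[K0 lK]]; split => //.
apply/linear_subspaceP; split; first exact/cone_value.
move=> a u v /(cone_value Fxy) Ku /(cone_value Fxy) Kv; apply/cone_value => //.
have := lK a _ _ Ku Kv; rewrite [_ *: _ + _](_ : _ = (0, a *: u + v))//.
by congr pair; rewrite /= scaler0 addr0.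
Qed.

(** This is continuity of v -> (0, v), checked on a product neighbourhood [B1] x [B2], where [B1]
    contains 0. *)
Lemma closure_cone_value (Fxy : F x y) (v : Y) :
  closure (cone (translate_sub (F x) y)) v ->
  closure (cone (translate_sub (gph F) (x, y))) (0, v).
Proof.
move=> cv B /= [[B1 B2] [/= B10 B2v] sB].
have [w [Kw B2w]] := cv _ B2v.
exists (0, w); split; first exact/cone_value.
by apply: sB; split => //=; exact: nbhs_singleton.
Qed.

(** The domain enters through [iri] because -u must lie in the cone itself to lift to a point of K;
    in the fibre, membership in the closure suffices. *)
Lemma qri_gph (cF : convex_set (gph F)) :
  iri (dom F) x -> qri (F x) y -> qri (gph F) (x, y).
Proof.
move=> [_ sD] [Fxy sF]; split => //.
have KD := cone_translateD (x := (x, y)) cF.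
apply: closure_linear_subspace => //.
- exact: cone_translate0.
- by move=> t u; exact: cone_translateZ.
move=> [u v] Kuv.
have /cone_dom[v' Kuv'] : cone (translate_sub (dom F) x) (- u).
  by apply: linear_subspaceN => //; apply/cone_dom; exists v.
have Kw : cone (translate_sub (F x) y) (v + v').
  apply/cone_value => //; have := KD _ _ Kuv Kuv'.
  by rewrite [_ + _](_ : _ = (0, v + v'))//; congr pair; rewrite /= subrr.
have Nw := linear_subspaceN sF (subset_closure Kw).
have := closureD KD (subset_closure Kuv') (closure_cone_value Fxy Nw).
rewrite [_ + _](_ : _ = - (u, v))//; congr pair; rewrite /= ?addr0//.
by rewrite opprD addrCA subrr addr0.
Qed.

End graph.

Theorem corollary4p4 (R : realType) (X Y : tvsType R) (F : X -> set Y)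
  (convF : convex_set (gph F))
  (qr_gph : quasi_regular (gph F))
  (qr_dom : quasi_regular (dom F)) :
  qri (gph F) = [set xy : X * Y | qri (dom F) xy.1 /\ qri (F xy.1) xy.2].
Proof.
(* Quasi-regularity of the domain supplies the [iri] hypothesis of [qri_gph]. *)
apply/seteqP; split=> -[x y] /=; rewrite qr_dom; last first.
  by move=> [xD yF]; exact: qri_gph.
(* Quasi-regularity of the graph makes K itself a subspace, which passes to its projection and its
   fibre. *)
rewrite qr_gph => xy; split; first exact: iri_gph_dom xy.
exact/iri_sub_qri/iri_gph_value.
Qed.
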